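(* Let $q=p_1\cdots p_k$ be a product of $k$ pairwise distinct primes. Let $P:\mathcal X\times\mathcal Y\to\{0,1\}$ be a predicate with $|\mathcal X|=|\mathcal Y|=n$ such that every matrix $F$ that represents $P$ modulo $q$ is (with respect to some fixed ordering of $\mathcal X$ and $\mathcal Y$) an $n\times n$ triangular matrix all of whose entries on the main diagonal are non-zero modulo $q$. Then $\mathrm{DI}(P,q)\ge n/k$.
   Context: A predicate is a function $P:\mathcal X\times\mathcal Y\to\{0,1\}$ with $\mathcal X,\mathcal Y$ finite nonempty sets. For an integer $q\ge 2$, a matrix $F\in\mathbb Z_q^{\mathcal X\times\mathcal Y}$ represents $P$ modulo $q$ if for all $x,y$: $F_{x,y}\equiv 0\pmod q$ iff $P(x,y)=1$. An inner product encoding of $P$ modulo $q$ of length $\ell$ is a pair of maps $x\mapsto \vec x\in\mathbb Z_q^\ell$, $y\mapsto\vec y\in\mathbb Z_q^\ell$ such that for all $x\in\mathcal X,y\in\mathcal Y$: $P(x,y)=1$ iff $\sum_{i=1}^\ell \vec x_i\vec y_i\equiv 0\pmod q$. $\mathrm{DI}(P,q)$ is the minimum length of such an encoding. *)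

(* Defs.v *)
From HB Require Import structures.
From mathcomp Require Import all_boot all_order all_algebra.

Set Implicit Arguments.
Unset Strict Implicit.
Unset Printing Implicit Defensive.

Import GRing.Theory.
Local Open Scope ring_scope.

(* Z_q is 'Z_q, which is Z/qZ only when 1 < q; every definition below is     *)
(* meant for such q.                                                         *)

Section Predicates.

Variables (X Y : finType) (P : X -> Y -> bool) (q : nat).

(* Matrices with rows indexed by X and columns by Y are functions, since     *)
(* MathComp matrices are indexed by ordinals.                                *)
Definition represents (F : X -> Y -> 'Z_q) : Prop :=
  forall x y, (F x y = 0) <-> P x y.

Definition ip_encoding (l : nat)
    (u : X -> 'rV['Z_q]_l) (v : Y -> 'rV['Z_q]_l) : bool :=
  [forall x, forall y, P x y == (\sum_(i < l) u x 0 i * v y 0 i == 0)].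

(* Finite functions make the existence of an encoding decidable, as ex_minn  *)
(* requires.                                                                 *)
Definition has_ip_encoding (l : nat) : bool :=
  [exists u : {ffun X -> 'rV['Z_q]_l},
    exists v : {ffun Y -> 'rV['Z_q]_l}, ip_encoding u v].

Lemma has_ip_encodingP (l : nat) :
  reflect (exists (u : X -> 'rV['Z_q]_l) (v : Y -> 'rV['Z_q]_l),
             forall x y, P x y <-> \sum_(i < l) u x 0 i * v y 0 i = 0)
          (has_ip_encoding l).
Proof.
apply: (iffP existsP) => [[u /existsP[v /forallP uvP]]|[u [v uvP]]].
  exists u, v => x y; have /forallP/(_ y)/eqP-> := uvP x.
  by split=> /eqP.
exists (finfun u); apply/existsP; exists (finfun v).
apply/forallP=> x; apply/forallP=> y; rewrite !ffunE; apply/eqP.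
by apply/idP/eqP => /uvP.
Qed.

(* x |-> the 0/1 row of the negation of P, y |-> the unit vector at y.       *)
Lemma ex_ip_encoding : exists l, has_ip_encoding l.
Proof.
exists #|Y|; apply/has_ip_encodingP.
exists (fun x => \row_j (~~ P x (enum_val j))%:R).
exists (fun y => \row_j (j == enum_rank y)%:R) => x y.
rewrite (bigD1 (enum_rank y)) //= big1 ?addr0 => [|j /negPf nj]; last first.
  by rewrite !mxE nj mulr0.
rewrite !mxE eqxx mulr1 enum_rankK; by case: (P x y).
Qed.

Definition DI : nat := ex_minn ex_ip_encoding.

End Predicates.

(* is_trig_mx is lower triangularity. *)
Definition triangular (R : nmodType) (n : nat) (A : 'M[R]_n) : bool :=
  is_trig_mx A || is_trig_mx A^T.

Definition ordered_mx (X Y : finType) (R : Type) (n : nat)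
    (sX : 'I_n -> X) (sY : 'I_n -> Y) (F : X -> Y -> R) : 'M[R]_n :=
  \matrix_(i < n, j < n) F (sX i) (sY j).

(* Main.v *)
(* Let [F] be the matrix of inner products of an encoding of length [l].  By  *)
(* the Chinese remainder theorem each of the [n] nonzero diagonal entries of  *)
(* [F] stays nonzero modulo some [p i].  Modulo [p i] the triangular matrix   *)
(* [F] has rank at least its number of nonzero diagonal entries and at most   *)
(* [l], as it factors through dimension [l].  Summing over [i], [n <= k * l]. *)

Require Import Defs.
From HB Require Import structures.
From mathcomp Require Import all_boot all_order all_algebra.

Set Implicit Arguments.
Unset Strict Implicit.
Unset Printing Implicit Defensive.

Import Order.TTheory GRing.Theory Num.Theory.
Local Open Scope ring_scope.

(** A low-rank factorization cannot be used over ['Z_q], which need not be a field, so ranks are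
    taken over each ['F_(p i)]: [prod_primes_dvdn] makes every diagonal position survive modulo some
    prime, and [triangular_leq_rank] allows each prime at most [l] survivors. [triangular_mulmx_leq]
    combines the two. *)

Lemma prod_primes_dvdn (I : finType) (p : I -> nat) (m : nat) :
    (forall i, prime (p i)) -> injective p -> (forall i, p i %| m)%N ->
  (\prod_i p i %| m)%N.
Proof.
move=> p_prime p_inj p_dvd; elim: (index_enum I) (index_enum_uniq I) => [|i r IHr].
  by rewrite big_nil dvd1n.
move=> /andP[i_r r_uniq]; rewrite big_cons Gauss_dvd ?p_dvd ?IHr //.
rewrite prime_coprime // Euclid_dvd_prod // big_has.
apply/hasPn => j j_r; rewrite dvdn_prime2 //.
by apply: contraNneq i_r => /p_inj ->.
Qed.

(** The principal submatrix on the indices in [S] is triangular with nonzero diagonal, hence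
    invertible, and its rank is at most that of [M]. *)
Lemma trig_mx_leq_rank (K : fieldType) (n : nat) (M : 'M[K]_n) :
  is_trig_mx M -> (#|[set i | M i i != 0%R]| <= \rank M)%N.
Proof.
set S := [set i | _] => /is_trig_mxP M_trig.
(* The enumeration of [S] must be increasing for the submatrix to stay triangular. *)
pose f := @Order.EnumVal.enum_val _ _ (mem S).
have f_mono : {mono f : i j / (i <= j)%O >-> (i <= j)%O}.
  by apply: Order.EnumVal.le_enum_val; apply: le_total.
have sub_trig : is_trig_mx (mxsub f f M).
  apply/is_trig_mxP => i j lt_ij; rewrite mxE M_trig //.
  by move: (f_mono j i); rewrite !leEord [RHS]leqNgt lt_ij ltnNge => ->.
have sub_unit : mxsub f f M \in unitmx.
  rewrite unitmxE det_trig // unitfE; apply/prodf_neq0 => i _; rewrite mxE.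
  by have := Order.EnumVal.enum_valP i; rewrite -/(f i) [_ \in _]inE.
rewrite -[leqLHS](mxrank_unit sub_unit) -[M in mxsub _ _ M]mulmx1 mxsub_mul.
exact: leq_trans (mxrankM_maxl _ _) (mxrankS (rowsub_sub _ _)).
Qed.

Lemma triangular_leq_rank (K : fieldType) (n : nat) (M : 'M[K]_n) :
  triangular M -> (#|[set i | M i i != 0%R]| <= \rank M)%N.
Proof.
case/orP => [/trig_mx_leq_rank //|/trig_mx_leq_rank].
rewrite mxrank_tr; apply: leq_trans; apply: eq_leq.
by apply: eq_card => i; rewrite !inE mxE.
Qed.

Lemma triangularP (R : nmodType) (n : nat) (A : 'M[R]_n) :
  triangular A <->
    (forall i j : 'I_n, (i < j)%N -> A i j = 0) \/
    (forall i j : 'I_n, (i < j)%N -> A j i = 0).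
Proof.
split=> [/orP[]/is_trig_mxP A_trig|[] A_trig]; [left|right| |] => //.
- by move=> i j /A_trig; rewrite mxE.
- by apply/orP; left; apply/is_trig_mxP.
- by apply/orP; right; apply/is_trig_mxP => i j /A_trig; rewrite mxE.
Qed.

Lemma natr_Zp_eq0 (q m : nat) : (1 < q)%N -> (m%:R == 0 :> 'Z_q) = (q %| m)%N.
Proof. by move=> q_gt1; rewrite -val_eqE /= val_Zp_nat. Qed.

Lemma natr_Fp_eq0 (p m : nat) : prime p -> (m%:R == 0 :> 'F_p) = (p %| m)%N.
Proof. by move=> p_prime; rewrite -(GRing.dvdn_pcharf (pchar_Fp p_prime)). Qed.

(* Lifting the matrices to [nat] lets one product be read modulo [q] and      *)
(* modulo each [p i].                                                         *)
Lemma triangular_mulmx_leq (k : nat) (p : 'I_k -> nat) (n l : nat)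
    (A : 'M[nat]_(n, l)) (B : 'M[nat]_(l, n)) (q := (\prod_(i < k) p i)%N)
    (M : 'M['Z_q]_n := map_mx (GRing.natmul 1) (A *m B)) :
    (0 < k)%N -> (forall i, prime (p i)) -> injective p ->
    triangular M -> (forall j, M j j != 0) ->
  (n <= k * l)%N.
Proof.
move=> k_gt0 p_prime p_inj M_trig M_diag.
have p_dvd i : (p i %| q)%N by rewrite /q (bigD1 i) //= dvdn_mulr.
(* This uses [0 < k]: an empty product would give [q = 1], and ['Z_1] is Z/2Z. *)
have q_gt1 : (1 < q)%N.
  apply: leq_trans (prime_gt1 (p_prime (Ordinal k_gt0))) _.
  by apply: dvdn_leq => //; apply: prodn_gt0 => i; apply: prime_gt0.
have M0 i j : (M i j == 0) = (q %| (A *m B) i j)%N by rewrite mxE natr_Zp_eq0.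
pose Mp i : 'M['F_(p i)]_n := map_mx (GRing.natmul 1) (A *m B).
have Mp0 i j1 j2 : (Mp i j1 j2 == 0) = (p i %| (A *m B) j1 j2)%N.
  by rewrite mxE natr_Fp_eq0.
have Mp_trig i : triangular (Mp i).
  have MMp j1 j2 : M j1 j2 = 0 -> Mp i j1 j2 = 0.
    by move=> /eqP; rewrite M0 => /(dvdn_trans (p_dvd i)); rewrite -Mp0 => /eqP.
  case/triangularP: M_trig => M_trig; apply/triangularP; [left|right] => j1 j2;
    by move=> /M_trig /MMp.
pose S i := [set j | Mp i j j != 0].
have S_leq i : (#|S i| <= l)%N.
  apply: leq_trans (triangular_leq_rank (Mp_trig i)) _.
  rewrite /Mp map_mxM; exact: leq_trans (mxrankM_maxl _ _) (rank_leq_col _).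
(* A diagonal entry vanishing modulo every [p i] would be divisible by [q], against [M_diag]. *)
have S_cover : [set: 'I_n] \subset \bigcup_i S i.
  apply/subsetP => j _; apply/bigcupP.
  have [i /negP Mij|Mj0] := pickP (fun i => Mp i j j != 0).
    by exists i => //; rewrite inE; apply/negP.
  case/negP: (M_diag j); rewrite M0; apply: prod_primes_dvdn => // i.
  by rewrite -Mp0; apply/negPn; rewrite Mj0.
rewrite -[n]card_ord -cardsT; apply: leq_trans (subset_leq_card S_cover) _.
apply: (@leq_trans (\sum_(i < k) #|S i|)%N).
  elim/big_rec2: _ => [|i m T _ leTm]; first by rewrite cards0.
  by apply: leq_trans (leq_card_setU _ _) _; rewrite leq_add2l.
rewrite -[k in (k * l)%N]card_ord -sum_nat_const.
exact: leq_sum (fun i _ => S_leq i).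
Qed.

Theorem theorem2 (k : nat) (p : 'I_k -> nat) (q : nat)
    (k_gt0 : (0 < k)%N)
    (p_prime : forall i, prime (p i))
    (p_inj : injective p)
    (q_def : q = (\prod_(i < k) p i)%N)
    (X Y : finType) (n : nat)
    (X_nonempty : (0 < #|X|)%N) (Y_nonempty : (0 < #|Y|)%N)
    (card_X : #|X| = n) (card_Y : #|Y| = n)
    (P : X -> Y -> bool)
    (P_triangular :
      exists (sX : 'I_n -> X) (sY : 'I_n -> Y),
        [/\ bijective sX, bijective sY &
          forall F : X -> Y -> 'Z_q, represents P F ->
            triangular (ordered_mx sX sY F) /\
            (forall i : 'I_n, ordered_mx sX sY F i i != 0)]) :
  n%:R / k%:R <= (DI P q)%:R :> rat.
Proof.
rewrite ler_pdivrMr ?ltr0n // -natrM ler_nat mulnC.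
case: P_triangular => sX [sY [_ _ P_trig]].
rewrite /DI; case: ex_minnP => l /has_ip_encodingP[u [v uvP]] _.
(* The inner products of a shortest encoding represent [P]. *)
have [|F_trig F_diag] := P_trig (fun x y => \sum_(i < l) u x 0 i * v y 0 i).
  by move=> x y; split=> /uvP.
subst q.
(* Canonical representatives of the residues; [natr_Zp] maps them back. *)
pose A : 'M[nat]_(n, l) := \matrix_(i, t) (u (sX i) 0 t : nat).
pose B : 'M[nat]_(l, n) := \matrix_(t, j) (v (sY j) 0 t : nat).
set M := ordered_mx _ _ _ in F_trig F_diag.
suff defM : M = map_mx (GRing.natmul 1) (A *m B).
  by apply: (@triangular_mulmx_leq _ p _ _ A B); rewrite -?defM.
apply/matrixP => i j; rewrite !mxE natr_sum; apply: eq_bigr => t _.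
by rewrite !mxE natrM !natr_Zp.
Qed.
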